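(* Let $n,t,\ell$ be positive integers, $k, k'$ non-negative integers, $\epsilon\ge 0$, and let $f\colon \mathbb{F}_2^n \times \mathbb{F}_2^t \to \mathbb{F}_2^\ell$ be a strong $k \to_\epsilon k'$ condenser. Put $K := 2^k$, $K' := 2^{k'}$, $L := 2^\ell$, $N := 2^n$, $T := 2^t$, $M := TL$. Suppose that real parameters $p, \nu, \gamma > 0$ satisfy \[ (p + \gamma)\frac{L}{K'} + \frac{\nu}{\gamma} < 1 - \epsilon, \] and that $D := \gamma L$ (an integer). Then the $M\times N$ adjacency matrix $\mathcal{M}$ of the codeword graph of $f$ is $\left(p M , (\nu/D)M, K-D, 0\right)$-correcting for $D$-sparse vectors. Moreover, there is an algorithm that, given any $\hat y\in\mathbb{F}_2^M$, outputs a valid decoding of $\hat y$ (with respect to these parameters) in time $O(MN)$.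
   Context: Min-entropy of a distribution $\mathcal{X}$ on a finite set: $H_\infty(\mathcal{X})=\min_x\{-\log_2 \Pr_{\mathcal{X}}(x)\}$ over its support. Two distributions on the same finite set are $\epsilon$-close if their statistical distance $\frac12\sum_s|\Pr_{\mathcal{X}}(s)-\Pr_{\mathcal{Y}}(s)|$ is at most $\epsilon$. $\mathcal{U}_t$ is the uniform distribution on $\mathbb{F}_2^t$. A function $f\colon \mathbb{F}_2^n\times\mathbb{F}_2^t\to\mathbb{F}_2^\ell$ is a strong $k\to_\epsilon k'$ condenser if for every distribution $\mathcal{X}$ on $\mathbb{F}_2^n$ with min-entropy at least $k$, with $X\sim\mathcal{X}$ and independent seed $Y\sim\mathcal{U}_t$, the distribution of $(Y,f(X,Y))$ is $\epsilon$-close to some distribution of the form $(\mathcal{U}_t,\mathcal{Z})$ with min-entropy at least $t+k'$. Codeword graph / adjacency matrix: the rows are indexed by pairs $(i,\sigma)\in\mathbb{F}_2^t\times\mathbb{F}_2^\ell$ (so there are $TL$ rows), the columns by $x\in\mathbb{F}_2^n$ (so $N$ columns), and the entry in row $(i,\sigma)$ and column $x$ is $1$ iff $f(x,i)=\sigma$ (i.e., $x$ is identified with the codeword $(f(x,i))_{i\in\mathbb{F}_2^t}$ of the code induced by $f$, adjacent to the right vertices $(i,f(x,i))$). A vector is $D$-sparse if it has at most $D$ nonzero coordinates. For an $M\times N$ binary matrix $A$ and $x\in\mathbb{F}_2^N$, $A[x]\in\mathbb{F}_2^M$ is the bitwise OR of the columns of $A$ indexed by the support of $x$. For non-negative reals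 $e_0,e_1$, an ordered pair $(x,y)$ of binary vectors of the same length is $(e_0,e_1)$-close if $y$ can be obtained from $x$ by flipping at most $e_0$ bits from $0$ to $1$ and at most $e_1$ bits from $1$ to $0$; otherwise it is $(e_0,e_1)$-far. $A$ is $(e_0,e_1,e'_0,e'_1)$-correcting for $D$-sparse vectors if for every $y\in\mathbb{F}_2^M$ there exists $z\in\mathbb{F}_2^N$ (a valid decoding of $y$) such that for every $D$-sparse $x\in\mathbb{F}_2^N$, whenever $(x,z)$ is $(e'_0,e'_1)$-far, $(A[x],y)$ is $(e_0,e_1)$-far.
   Formalization: The hypothesis k ≤ n is added: for k > n every f is vacuously a strong condenser and the claim fails (e.g. n=1, k=2, t=ℓ=1, k'=10, ε=0, f constant, γ=2, D=4, p=1, ν=1/2). *)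

(* Defs.v *)
From HB Require Import structures.
From mathcomp Require Import all_boot all_order all_algebra.
From mathcomp Require Import all_classical all_reals all_analysis.

Set Implicit Arguments.
Unset Strict Implicit.
Unset Printing Implicit Defensive.

Import Order.TTheory GRing.Theory Num.Theory.
Local Open Scope ring_scope.

(** * Distributions on finite sets *)

Section Distributions.
Context {R : realType}.

Definition is_dist (A : finType) (P : {ffun A -> R}) : Prop :=
  (forall a, 0 <= P a) /\ \sum_a P a = 1.

Definition unif_dist (A : finType) : {ffun A -> R} := [ffun=> #|A|%:R^-1].

Definition indep_dist (A B : finType) (P : {ffun A -> R}) (Q : {ffun B -> R}) :
  {ffun A * B -> R} := [ffun ab => P ab.1 * Q ab.2].

(* law of g(a) for a distributed according to P *)
Definition push_dist (A B : finType) (g : A -> B) (P : {ffun A -> R}) :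
  {ffun B -> R} := [ffun b => \sum_(a | g a == b) P a].

Definition log2 (x : R) : R := ln x / ln 2.

(* The default value +oo is reached only when the support is empty, which does
   not happen for a distribution. *)
Definition min_entropy (A : finType) (P : {ffun A -> R}) : \bar R :=
  \big[Order.min/+oo%E]_(a | P a != 0) (- log2 (P a))%:E.

Definition stat_dist (A : finType) (P Q : {ffun A -> R}) : R :=
  2^-1 * \sum_a `|P a - Q a|.

(* The law Z of the pair (U_t, Z) is an arbitrary distribution whose first
   marginal is uniform; its second component may depend on the seed. *)
Definition strong_condenser (n t l k k' : nat) (eps : R)
    (f : 'rV['F_2]_n -> 'rV['F_2]_t -> 'rV['F_2]_l) : Prop :=
  forall X : {ffun 'rV['F_2]_n -> R},
    is_dist X -> (k%:R%:E <= min_entropy X)%E ->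
    exists Z : {ffun 'rV['F_2]_t * 'rV['F_2]_l -> R},
      [/\ is_dist Z,
          push_dist fst Z = unif_dist 'rV['F_2]_t,
          ((t + k')%:R%:E <= min_entropy Z)%E &
          stat_dist
            (push_dist (fun xy => (xy.2, f xy.1 xy.2))
                       (indep_dist X (unif_dist 'rV['F_2]_t)))
            Z <= eps].

End Distributions.

(** * Codeword graphs *)

Lemma card_F2vec n : #|{: 'rV['F_2]_n}| = (2 ^ n)%N.
Proof. by rewrite card_mx card_Fp // mul1n. Qed.

Lemma card_F2vec_pair t l :
  #|{: 'rV['F_2]_t * 'rV['F_2]_l}| = (2 ^ t * 2 ^ l)%N.
Proof. by rewrite card_prod !card_F2vec. Qed.

(* Enumerations of the column and row labels by ordinals, so that the adjacency
   matrix is a genuine M x N matrix. *)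
Definition col_label n (c : 'I_(2 ^ n)) : 'rV['F_2]_n :=
  enum_val (cast_ord (esym (card_F2vec n)) c).

Definition row_label t l (r : 'I_(2 ^ t * 2 ^ l)) :
  'rV['F_2]_t * 'rV['F_2]_l :=
  enum_val (cast_ord (esym (card_F2vec_pair t l)) r).

Definition codeword_mx (n t l : nat)
    (f : 'rV['F_2]_n -> 'rV['F_2]_t -> 'rV['F_2]_l) :
    'M['F_2]_(2 ^ t * 2 ^ l, 2 ^ n) :=
  \matrix_(r, c)
    (f (col_label c) (row_label r).1 == (row_label r).2)%:R.

(** * Disjunctive measurements and error correction *)

Definition sparse (D : nat) (N : nat) (x : 'rV['F_2]_N) : Prop :=
  (#|[set j | (x 0 j != 0)%R]| <= D)%N.

Definition or_mx (M N : nat) (A : 'M['F_2]_(M, N)) (x : 'rV['F_2]_N) :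
    'rV['F_2]_M :=
  \row_i ([exists j, (x 0 j != 0) && (A i j != 0)])%:R.

Section Correcting.
Context {R : realType}.

Definition bits_close (e0 e1 : R) (m : nat) (x y : 'rV['F_2]_m) : Prop :=
  (#|[set i | (x 0 i == 0) && (y 0 i == 1)]|%:R <= e0) /\
  (#|[set i | (x 0 i == 1) && (y 0 i == 0)]|%:R <= e1).

Definition bits_far (e0 e1 : R) (m : nat) (x y : 'rV['F_2]_m) : Prop :=
  ~ bits_close e0 e1 x y.

Definition valid_decoding (M N : nat) (A : 'M['F_2]_(M, N)) (D : nat)
    (e0 e1 e0' e1' : R) (y : 'rV['F_2]_M) (z : 'rV['F_2]_N) : Prop :=
  forall x : 'rV['F_2]_N, sparse D x ->
    bits_far e0' e1' x z -> bits_far e0 e1 (or_mx A x) y.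

Definition correcting (M N : nat) (A : 'M['F_2]_(M, N)) (D : nat)
    (e0 e1 e0' e1' : R) : Prop :=
  forall y : 'rV['F_2]_M, exists z : 'rV['F_2]_N,
    valid_decoding A D e0 e1 e0' e1' y z.

End Correcting.

(** * Random access machines *)

(* A unit-cost RAM with registers and an indirectly addressed memory, both
   holding natural numbers. Arithmetic is limited to +1 and -1: a value exceeds
   the inputs and program constants by at most the number of steps, so charging
   one unit
   per instruction does not hide computations on huge numbers. *)
Inductive ram_instr : Type :=
| IConst of nat & nat   (* IConst i c : reg[i] := c                *)
| IMove of nat & nat    (* IMove i j  : reg[i] := reg[j]           *)
| ISucc of nat          (* ISucc i    : reg[i] := reg[i] + 1       *)
| IPred of nat          (* IPred i    : reg[i] := max(reg[i]-1, 0) *)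
| ILoad of nat & nat    (* ILoad i j  : reg[i] := mem[reg[j]]      *)
| IStore of nat & nat   (* IStore i j : mem[reg[i]] := reg[j]      *)
| IJump of nat & nat.   (* IJump i q  : if reg[i] > 0 then goto q  *)

Definition ram_program := seq ram_instr.

Record ram_state := RamState {
  ram_pc : nat;
  ram_reg : nat -> nat;
  ram_mem : nat -> nat }.

Definition upd (g : nat -> nat) (a v : nat) : nat -> nat :=
  fun b => if b == a then v else g b.

Definition ram_exec (i : ram_instr) (s : ram_state) : ram_state :=
  let: RamState pc r m := s in
  match i with
  | IConst a c => RamState pc.+1 (upd r a c) m
  | IMove a b => RamState pc.+1 (upd r a (r b)) m
  | ISucc a => RamState pc.+1 (upd r a (r a).+1) m
  | IPred a => RamState pc.+1 (upd r a (r a).-1) m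
  | ILoad a b => RamState pc.+1 (upd r a (m (r b))) m
  | IStore a b => RamState pc.+1 r (upd m (r a) (r b))
  | IJump a q => RamState (if (0 < r a)%N then q else pc.+1) r m
  end.

(* The machine halts when the program counter leaves the program. *)
Definition ram_step (P : ram_program) (s : ram_state) : ram_state :=
  if onth P (ram_pc s) is Some i then ram_exec i s else s.

Definition ram_halted (P : ram_program) (s : ram_state) : Prop :=
  (size P <= ram_pc s)%N.

(* Address of the output buffer, just after y and the entries of the matrix. *)
Definition out_addr (M N : nat) : nat := (M + M * N)%N.

(* Initial state for decoding y. Memory holds y followed by the matrix, column
   by column, one bit per cell; registers 0, 1, 2, ... hold the dimensions, the
   sparsity, the error parameters and the output address. The numbers of flipped
   bits being integers, closeness for e0, e1 depends only on the integer parts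
   of e0 and e1, which are what the machine receives. *)
Definition decoder_input {R : realType} (M N : nat) (A : 'M['F_2]_(M, N))
    (D : nat) (e0 e1 e0' e1' : R) (y : 'rV['F_2]_M) : ram_state :=
  RamState 0
    (nth 0%N [:: M; N; D; Num.truncn e0; Num.truncn e1;
                 Num.truncn e0'; Num.truncn e1'; out_addr M N])
    (nth 0%N ([seq nat_of_ord (y 0 i) | i <- enum 'I_M]
              ++ [seq nat_of_ord (A i j) | j <- enum 'I_N, i <- enum 'I_M])).

Definition decoder_output (M N : nat) (s : ram_state) (z : 'rV['F_2]_N) : Prop :=
  forall j : 'I_N, ram_mem s (out_addr M N + j)%N = nat_of_ord (z 0 j).

Definition outputs_within (P : ram_program) (s0 : ram_state) (time : nat)
    (M N : nat) (z : 'rV['F_2]_N) : Prop :=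
  exists2 q : nat, (q <= time)%N &
    ram_halted P (iter q (ram_step P) s0) /\
    decoder_output M (iter q (ram_step P) s0) z.

(* Main.v *)
Require Import Defs.
From mathcomp Require Import all_boot all_order all_algebra.
From mathcomp Require Import all_classical all_reals all_analysis.
(* Imported last so that the names shared with classical_sets refer to finite
   sets. *)
From mathcomp Require Import fintype finset.
From mathcomp Require Import zify ring lra.

Set Implicit Arguments.
Unset Strict Implicit.
Unset Printing Implicit Defensive.

Import Order.TTheory GRing.Theory Num.Theory.
Local Open Scope ring_scope.

(** The decoder keeps the set J of all columns with at most e1 ones outside the
    support of y. If (A[x], y) is (e0, e1)-close, every column of supp x is in
    J, so no 1 of x is lost. If |J \ supp x| > K - D, enlarge J to a set J' of
    at least K columns by adding at most D - |supp x| of them; this padding is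
    what handles vectors x of weight less than D. Let B consist of the ones of y
    outside A[x] together with the columns in supp x and J' \ J: it has at most
    (p + gamma) M elements, and every column of J' has at most e1 ones outside
    B. But fewer than K codewords can be so close to B: for X uniform on K or
    more of them, (Y, f(X, Y)) would fall in B with probability at least
    1 - nu / gamma, whereas a source of min-entropy t + k' does so with
    probability at most |B| / (T K') <= (p + gamma) L / K'. *)

Lemma exists_supset_card (T : finType) (A : {set T}) (k : nat) :
  (#|A| <= k <= #|T|)%N -> exists2 B : {set T}, A \subset B & #|B| = k.
Proof.
elim: k => [|k IHk] /andP[]; first by exists A => //; lia.
rewrite leq_eqVlt => /predU1P[<- _|Ak kT]; first by exists A.
have [|B AB Bk] := IHk; first by rewrite -ltnS Ak ltnW.
have /card_gt0P[x] : (0 < #|~: B|)%N by have := cardsC B; lia.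
rewrite inE => xB; exists (x |: B); last by rewrite cardsU1 xB Bk.
exact: subset_trans AB (subsetUr _ _).
Qed.

Lemma leq_card_bigcup (I T : finType) (P : pred I) (F : I -> {set T}) :
  (#|\bigcup_(i | P i) F i| <= \sum_(i | P i) #|F i|)%N.
Proof.
elim/big_rec2: _ => [|i m U _ Um]; first by rewrite cards0.
exact: leq_trans (leq_card_setU _ _) (leq_add (leqnn _) Um).
Qed.

Lemma nth_allpairs (S T U : Type) (f : S -> T -> U) x0 y0 u0
    (s : seq S) (t : seq T) (i j : nat) : (i < size s)%N -> (j < size t)%N ->
  nth u0 [seq f x y | x <- s, y <- t] (i * size t + j) =
  f (nth x0 s i) (nth y0 t j).
Proof.
elim: s i => // x s IHs [|i] /= ltis ltjt; rewrite nth_cat size_map.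
  by rewrite mul0n add0n ltjt (nth_map y0).
by rewrite mulSn -addnA ltnNge leq_addr /= addKn IHs.
Qed.

Lemma natrb_eq0 (R : nzSemiRingType) (b : bool) : (b%:R == 0 :> R) = ~~ b.
Proof. by case: b; rewrite ?oner_eq0 ?eqxx. Qed.

Lemma F2_neq0 (x : 'F_2) : (x != 0) = (x == 1).
Proof. by case: x => [[|[|]]]. Qed.

Section Probability.
Context {R : realType}.
Implicit Types (A B : finType) (k : R).

Definition prob A (P : {ffun A -> R}) (E : {set A}) : R := \sum_(a in E) P a.

Lemma prob_setC A (P : {ffun A -> R}) (E : {set A}) :
  is_dist P -> prob P (~: E) = 1 - prob P E.
Proof.
case=> _ <-; rewrite /prob [in RHS](bigID (mem E)) /= addrC addrK.
by apply: eq_bigl => a; rewrite inE.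
Qed.

Lemma prob_push_dist A B (g : A -> B) (P : {ffun A -> R}) (E : {set B}) :
  prob (push_dist g P) E = prob P (g @^-1: E).
Proof.
rewrite /prob (partition_big g (mem E)) => [|a]; last by rewrite inE.
apply: eq_bigr => b bE; rewrite ffunE; apply: eq_bigl => a.
by rewrite inE andbC; case: eqP => // ->.
Qed.

Lemma prob_unif_dist A (E : {set A}) :
  prob (unif_dist A) E = #|E|%:R / #|A|%:R :> R.
Proof.
by rewrite mulr_natl -sumr_const; apply: eq_bigr => a _; rewrite ffunE.
Qed.

Lemma prob_indep_dist A B (P : {ffun A -> R}) (Q : {ffun B -> R})
    (E : {set A * B}) :
  prob (indep_dist P Q) E = \sum_a P a * prob Q [set b | (a, b) \in E].
Proof.
under [RHS]eq_bigr do rewrite mulr_sumr.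
rewrite pair_big_dep /=; apply: eq_big => -[a b]; first by rewrite inE.
by rewrite ffunE.
Qed.

Lemma prob_sub_le_stat_dist A (P Q : {ffun A -> R}) (E : {set A}) :
  is_dist P -> is_dist Q -> prob P E - prob Q E <= stat_dist P Q.
Proof.
move=> distP distQ.
have norm_prob_sub_le (F : {set A}) :
    `|prob P F - prob Q F| <= \sum_(a in F) `|P a - Q a|.
  by rewrite -sumrB; exact: ler_norm_sum.
rewrite /stat_dist (bigID (mem E)) /=.
rewrite [X in _ * (_ + X)](eq_bigl (mem (~: E))) => [|a]; last by rewrite !inE.
have := norm_prob_sub_le E; have := norm_prob_sub_le (~: E).
by rewrite !prob_setC // !ler_norml; lra.
Qed.

Lemma is_dist_push A B (g : A -> B) (P : {ffun A -> R}) :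
  is_dist P -> is_dist (push_dist g P).
Proof.
move=> [P_ge0 P1]; split=> [b|]; first by rewrite ffunE sumr_ge0.
rewrite -P1 [RHS](partition_big g xpredT) //.
by apply: eq_bigr => b _; rewrite ffunE.
Qed.

Lemma is_dist_indep A B (P : {ffun A -> R}) (Q : {ffun B -> R}) :
  is_dist P -> is_dist Q -> is_dist (indep_dist P Q).
Proof.
move=> [P_ge0 P1] [Q_ge0 Q1]; split=> [ab|]; first by rewrite ffunE mulr_ge0.
under eq_bigr do rewrite ffunE.
rewrite -(pair_bigA _ (fun a b => P a * Q b)) /=.
by under eq_bigr do rewrite -mulr_sumr Q1 mulr1.
Qed.

Definition unif_on A (S : {set A}) : {ffun A -> R} :=
  [ffun a => if a \in S then #|S|%:R^-1 else 0].

Lemma is_dist_unif_on A (S : {set A}) : (0 < #|S|)%N -> is_dist (unif_on S).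
Proof.
move=> S_gt0; split=> [a|]; first by rewrite ffunE; case: ifP.
under eq_bigr do rewrite ffunE.
by rewrite -big_mkcond sumr_const -[LHS]mulr_natl mulfV // pnatr_eq0 -lt0n.
Qed.

Lemma unif_distE A : unif_dist A = unif_on [set: A].
Proof. by apply/ffunP => a; rewrite !ffunE inE cardsT. Qed.

Lemma log2_le (x k : R) : 0 < x -> (log2 x <= k) = (x <= 2 `^ k).
Proof.
move=> x_gt0; rewrite /log2 ler_pdivrMr ?ln_gt0 ?ltr1n // -ln_powR.
by rewrite ler_ln ?posrE ?powR_gt0.
Qed.

Lemma le_min_entropyP A (P : {ffun A -> R}) k : (forall a, 0 <= P a) ->
  (k%:E <= min_entropy P)%E <-> forall a, P a <= 2 `^ (- k).
Proof.
move=> P_ge0.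
have atom_le a : P a != 0 ->
    (k%:E <= (- log2 (P a))%:E)%E = (P a <= 2 `^ (- k)).
  by move=> Pa; rewrite lee_fin lerNr log2_le // lt_def Pa P_ge0.
split=> [/bigmin_geP[_ le_k] a|le_k].
  have [->|Pa] := eqVneq (P a) 0; first exact: powR_ge0.
  by rewrite -atom_le ?le_k.
by apply/bigmin_geP; split=> [|a Pa]; rewrite ?leey ?atom_le.
Qed.

Lemma min_entropy_unif_on A (S : {set A}) k :
  2 `^ k <= #|S|%:R -> (k%:E <= min_entropy (unif_on S))%E.
Proof.
move=> le_kS.
have S_gt0 : 0 < #|S|%:R :> R by apply: lt_le_trans le_kS; exact: powR_gt0.
apply/le_min_entropyP=> a; rewrite ffunE; first by case: ifP.
case: ifP => _; last exact: powR_ge0.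
by rewrite powRN lef_pV2 ?posrE ?powR_gt0.
Qed.

Lemma prob_le_min_entropy A (P : {ffun A -> R}) k (E : {set A}) :
  is_dist P -> (k%:E <= min_entropy P)%E -> prob P E <= #|E|%:R / 2 `^ k.
Proof.
move=> [P_ge0 _] /(le_min_entropyP _ P_ge0) le_k.
by rewrite mulr_natl -powRN -sumr_const; exact: ler_sum.
Qed.

End Probability.

Section SeededFunctions.
Context {R : realType}.
Variables (A B C : finType) (f : A -> B -> C).
Implicit Types (x : A) (X : {ffun A -> R}) (E : {set B * C}).

Definition codeword x : {set B * C} := [set (i, f x i) | i : B].

Lemma in_codeword x u : (u \in codeword x) = (f x u.1 == u.2).
Proof.
apply/imsetP/eqP => [[i _ ->] //|fu].
by exists u.1; rewrite // fu -surjective_pairing.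
Qed.

Lemma card_codeword x : #|codeword x| = #|B|.
Proof. by rewrite card_imset // => i j []. Qed.

Definition seeded_dist X : {ffun B * C -> R} :=
  push_dist (fun xy => (xy.2, f xy.1 xy.2)) (indep_dist X (unif_dist B)).

Lemma is_dist_seeded X :
  (0 < #|B|)%N -> is_dist X -> is_dist (seeded_dist X).
Proof.
move=> B_gt0 distX; apply/is_dist_push/is_dist_indep => //.
by rewrite unif_distE; apply: is_dist_unif_on; rewrite cardsT.
Qed.

Lemma prob_seeded_dist X E :
  prob (seeded_dist X) E = \sum_x X x * (#|codeword x :&: E|%:R / #|B|%:R).
Proof.
rewrite prob_push_dist prob_indep_dist; apply: eq_bigr => x _.
rewrite prob_unif_dist; congr (_ * (_%:R / _)).
rewrite -(card_imset _ (_ : injective (fun i => (i, f x i)))) => [|i j [] //].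
apply: eq_card => u; rewrite inE in_codeword.
apply/imsetP/andP => [[i]|[/eqP fu uE]]; first by rewrite !inE => iE ->.
by exists u.1; rewrite ?inE /= fu -surjective_pairing.
Qed.

Lemma prob_seeded_dist_le X E (delta : R) :
  (0 < #|B|)%N -> is_dist X ->
  (forall x, X x != 0 -> #|codeword x :&: E|%:R <= delta * #|B|%:R) ->
  prob (seeded_dist X) E <= delta.
Proof.
move=> B_gt0 [X_ge0 sumX] le_delta.
rewrite prob_seeded_dist -[leRHS]mul1r -[X in X * delta]sumX mulr_suml.
apply: ler_sum => x _; have [->|Xx] := eqVneq (X x) 0; first by rewrite !mul0r.
by rewrite ler_wpM2l // ler_pdivrMr ?ltr0n // le_delta.
Qed.

End SeededFunctions.

Lemma condenser_list_size (R : realType) (n t l k k' : nat) (eps delta : R)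
    (f : 'rV['F_2]_n -> 'rV['F_2]_t -> 'rV['F_2]_l)
    (E : {set 'rV['F_2]_t * 'rV['F_2]_l}) :
  strong_condenser k k' eps f ->
  #|E|%:R / (2 ^ t * 2 ^ k')%:R + delta < 1 - eps ->
  (#|[set x | (#|codeword f x :\: E|%:R <= delta * (2 ^ t)%:R)%R]| < 2 ^ k)%N.
Proof.
move=> condf lt_eps; rewrite ltnNge; apply/negP; set S := [set x | _] => le_kS.
have T_gt0 : (0 < #|{: 'rV['F_2]_t}|)%N by rewrite card_F2vec expn_gt0.
have distX : is_dist (unif_on S : {ffun _ -> R}).
  by apply: is_dist_unif_on; apply: leq_trans le_kS; rewrite expn_gt0.
have [|Z [distZ _ entZ]] := condf _ distX.
  by apply: min_entropy_unif_on; rewrite powR_mulrn // -natrX ler_nat.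
rewrite -/(seeded_dist f (unif_on S)) => closeZ.
have prob_missed : prob (seeded_dist f (unif_on S)) (~: E) <= delta.
  apply: prob_seeded_dist_le => // x; rewrite -setDE ffunE card_F2vec.
  by case: ifP => [|_]; rewrite ?eqxx // inE.
have distY := is_dist_seeded f T_gt0 distX; rewrite prob_setC // in prob_missed.
have probZ : prob Z E <= #|E|%:R / (2 ^ t * 2 ^ k')%:R.
  have := prob_le_min_entropy E distZ entZ.
  by rewrite powR_mulrn // -natrX expnD.
have := prob_sub_le_stat_dist E distY distZ; lra.
Qed.

Definition row_supp (V : nmodType) (N : nat) (x : 'rV[V]_N) : {set 'I_N} :=
  [set j | x 0 j != 0].

Definition col_supp (V : nmodType) (M N : nat) (A : 'M[V]_(M, N)) (j : 'I_N) :
    {set 'I_M} :=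
  [set i | A i j != 0].

Lemma row_supp_or_mx (M N : nat) (A : 'M['F_2]_(M, N)) (x : 'rV['F_2]_N) :
  row_supp (or_mx A x) = \bigcup_(j in row_supp x) col_supp A j.
Proof.
apply/setP => i; rewrite inE mxE natrb_eq0 negbK.
apply/existsP/bigcupP => [[j /andP[xj Aij]]|[j]].
  by exists j; rewrite inE.
by rewrite !inE => xj Aij; exists j; rewrite xj.
Qed.

Lemma row_suppD (m : nat) (x y : 'rV['F_2]_m) :
  row_supp x :\: row_supp y = [set i | (x 0 i == 1) && (y 0 i == 0)].
Proof. by apply/setP => i; rewrite !inE negbK F2_neq0 andbC. Qed.

Lemma bits_closeE (R : realType) (e0 e1 : R) (m : nat) (x y : 'rV['F_2]_m) :
  bits_close e0 e1 x y =
  (#|row_supp y :\: row_supp x|%:R <= e0 /\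
   #|row_supp x :\: row_supp y|%:R <= e1).
Proof.
by rewrite !row_suppD /bits_close; under [in LHS]eq_finset do rewrite andbC.
Qed.

Section ThresholdDecoding.
Context {R : realType}.
Variables (M N : nat) (A : 'M['F_2]_(M, N)).
Implicit Types (e : R) (B C : {set 'I_M}) (y : 'rV['F_2]_M).

Definition near_cols e B : {set 'I_N} :=
  [set j | #|col_supp A j :\: B|%:R <= e].

Lemma near_colsS e B C : B \subset C -> near_cols e B \subset near_cols e C.
Proof.
move=> BC; apply/subsetP => j; rewrite !inE; apply: le_trans.
by rewrite ler_nat subset_leq_card // setDS.
Qed.

Lemma sub_near_cols e B j :
  0 <= e -> col_supp A j \subset B -> j \in near_cols e B.
Proof. by move=> e_ge0; rewrite -setD_eq0 inE => /eqP->; rewrite cards0. Qed.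

Definition threshold_decode e y : 'rV['F_2]_N :=
  \row_j (j \in near_cols e (row_supp y))%:R.

Lemma row_supp_threshold_decode e y :
  row_supp (threshold_decode e y) = near_cols e (row_supp y).
Proof. by apply/setP => j; rewrite inE mxE natrb_eq0 negbK. Qed.

Lemma threshold_decode_valid (D K w : nat) (e0 e1 : R) y :
  (forall j, #|col_supp A j| <= w)%N -> (K <= N)%N -> 0 <= e1 ->
  (forall B, #|B|%:R <= e0 + (D * w)%:R -> (#|near_cols e1 B| < K)%N) ->
  valid_decoding A D e0 e1 (K%:R - D%:R) 0 y (threshold_decode e1 y).
Proof.
move=> col_le_w leKN e1_ge0 list_lt x xD far; rewrite /bits_far bits_closeE.
rewrite row_supp_or_mx; move=> [close0 close1]; apply: far.
rewrite bits_closeE row_supp_threshold_decode.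
set X := row_supp x in close0 close1 *; set Y := row_supp y in close0 close1 *.
set J := near_cols e1 Y; set AX := \bigcup_(j in X) _ in close0 close1.
have XJ : X \subset J.
  apply/subsetP => j jX; rewrite inE (le_trans _ close1) // ler_nat.
  by rewrite subset_leq_card // setSD // bigcup_sup.
split; last by move: XJ; rewrite -setD_eq0 => /eqP->; rewrite cards0.
rewrite leNgt ltrBlDr -natrD ltr_nat cardsDS //; apply/negP => manyJ.
have [|J' JJ' cardJ'] := @exists_supset_card _ J (maxn #|J| K).
  by rewrite leq_maxl geq_max max_card card_ord.
pose B := (Y :\: AX) :|: \bigcup_(j in X :|: (J' :\: J)) col_supp A j.
have cardB : #|B|%:R <= e0 + (D * w)%:R :> R.
  apply: le_trans (lerD close0 (lexx _)); rewrite -natrD ler_nat.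
  apply: leq_trans (leq_card_setU _ _) _; rewrite leq_add2l.
  apply: leq_trans (leq_card_bigcup _ _) _.
  apply: (@leq_trans (\sum_(j in X :|: (J' :\: J)) w)); first exact: leq_sum.
  rewrite sum_nat_const leq_mul2r; apply/orP; right.
  apply: leq_trans (leq_card_setU _ _) _; rewrite cardsDS // cardJ'.
  by have := subset_leq_card XJ; have : (#|X| <= D)%N := xD; lia.
have YB : Y \subset B by rewrite /B bigcup_setU setUCA -subDset subsetUl.
have J'B : J' \subset near_cols e1 B.
  apply/subsetP => j jJ'; have [jJ|jJ] := boolP (j \in J).
    exact: (subsetP (near_colsS e1 YB)).
  apply: sub_near_cols => //; apply/subsetU/orP; right; apply: bigcup_sup.
  by rewrite in_setU in_setD jJ' jJ orbT.
have := leq_ltn_trans (subset_leq_card J'B) (list_lt B cardB).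
by rewrite cardJ' ltnNge leq_maxr.
Qed.

End ThresholdDecoding.

Section CodewordMatrix.
Variables (n t l : nat) (f : 'rV['F_2]_n -> 'rV['F_2]_t -> 'rV['F_2]_l).
Context {R : realType}.

Lemma col_label_bij : bijective (@col_label n).
Proof.
by apply: inj_card_bij => [c c' /enum_val_inj/cast_ord_inj //|];
  rewrite card_F2vec card_ord.
Qed.

Lemma row_label_bij : bijective (@row_label t l).
Proof.
by apply: inj_card_bij => [r r' /enum_val_inj/cast_ord_inj //|];
  rewrite card_F2vec_pair card_ord.
Qed.

Lemma col_supp_codeword_mx c :
  col_supp (codeword_mx f) c = @row_label t l @^-1: codeword f (col_label c).
Proof. by apply/setP => r; rewrite !inE in_codeword mxE natrb_eq0 negbK. Qed.

Lemma card_col_supp_codeword_mx c : #|col_supp (codeword_mx f) c| = (2 ^ t)%N.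
Proof.
rewrite col_supp_codeword_mx on_card_preimset; last exact/onW_bij/row_label_bij.
by rewrite card_codeword card_F2vec.
Qed.

Lemma near_cols_codeword_mx (e : R) (E : {set 'rV['F_2]_t * 'rV['F_2]_l}) :
  near_cols (codeword_mx f) e (@row_label t l @^-1: E) =
  @col_label n @^-1: [set x | #|codeword f x :\: E|%:R <= e].
Proof.
apply/setP => c; rewrite !inE col_supp_codeword_mx -preimsetD.
by rewrite on_card_preimset //; exact/onW_bij/row_label_bij.
Qed.

Lemma codeword_mx_list_size (k k' : nat) (eps delta : R)
    (B : {set 'I_(2 ^ t * 2 ^ l)}) :
  strong_condenser k k' eps f ->
  #|B|%:R / (2 ^ t * 2 ^ k')%:R + delta < 1 - eps ->
  (#|near_cols (codeword_mx f) (delta * (2 ^ t)%:R) B| < 2 ^ k)%N.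
Proof.
move=> condf lt_eps; pose E := @row_label t l @: B.
have label_inj := bij_inj row_label_bij.
have -> : B = @row_label t l @^-1: E.
  by apply/setP => r; rewrite inE mem_imset.
rewrite near_cols_codeword_mx on_card_preimset.
  by apply: condenser_list_size condf _; rewrite card_imset.
exact/onW_bij/col_label_bij.
Qed.

Lemma codeword_threshold_decode_valid (k k' : nat) (eps p delta : R) (D : nat)
    (y : 'rV['F_2]_(2 ^ t * 2 ^ l)) :
  strong_condenser k k' eps f -> (k <= n)%N -> 0 <= delta ->
  (p * (2 ^ l)%:R + D%:R) / (2 ^ k')%:R + delta < 1 - eps ->
  valid_decoding (codeword_mx f) D (p * (2 ^ t * 2 ^ l)%:R)
    (delta * (2 ^ t)%:R) ((2 ^ k)%:R - D%:R) 0 y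
    (threshold_decode (codeword_mx f) (delta * (2 ^ t)%:R) y).
Proof.
move=> condf le_kn delta_ge0 lt_eps.
apply: (threshold_decode_valid (w := 2 ^ t)).
- by move=> c; rewrite card_col_supp_codeword_mx.
- by rewrite leq_exp2l.
- exact: mulr_ge0.
move=> B leB; apply: codeword_mx_list_size condf _.
apply: le_lt_trans lt_eps; rewrite lerD2r natrM invfM mulrA.
rewrite ler_pM2r ?invr_gt0 ?ltr0n ?expn_gt0 // ler_pdivrMr ?ltr0n ?expn_gt0 //.
by rewrite (le_trans leB) // !natrM mulrDl -!mulrA [X in p * X]mulrC.
Qed.

End CodewordMatrix.

Section Reachability.
Variable P : ram_program.

Definition ram_reaches (time : nat) (s s' : ram_state) : Prop :=
  exists2 q, (q <= time)%N & iter q (ram_step P) s = s'.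

Lemma ram_reaches_trans (time time' : nat) (s s' s'' : ram_state) :
  ram_reaches time s s' -> ram_reaches time' s' s'' ->
  ram_reaches (time + time') s s''.
Proof.
move=> [q le_q run] [q' le_q' run']; exists (q + q')%N; first exact: leq_add.
by rewrite addnC iterD run.
Qed.

Lemma ram_reaches_loop (time c : nat) (inv : nat -> ram_state -> Prop)
    (s : ram_state) :
  (forall j s, (j < c)%N -> inv j s ->
     exists2 s', ram_reaches time s s' & inv j.+1 s') ->
  inv 0%N s -> exists2 s', ram_reaches (c * time) s s' & inv c s'.
Proof.
elim: c => [|c IHc] body inv0; first by exists s => //; exists 0%N.
have [j s' jc|s' run inv_c] := IHc _ inv0; first exact/body/ltnW.
have [s'' run' inv_c1] := body _ _ (ltnSn c) inv_c.
by exists s''; rewrite // mulSnr; exact: ram_reaches_trans run run'.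
Qed.

End Reachability.

Lemma upd_id (g : nat -> nat) a : upd g a (g a) = g.
Proof. by apply/funext => b; rewrite /upd; case: eqP => [->|]. Qed.

Lemma upd_upd (g : nat -> nat) a v w : upd (upd g a v) a w = upd g a w.
Proof. by apply/funext => b; rewrite /upd; case: eqP. Qed.

(* m holds the received word from cell 0 on and a matrix column from cell col
   on, both of height h. *)
Definition missed_ones (m : nat -> nat) (col h : nat) : nat :=
  (\sum_(i < h) ((m i == 0) && (m (col + i) != 0)))%N.

Lemma eq_missed_ones (m m' : nat -> nat) (col h b : nat) :
  (h <= b)%N -> (col + h <= b)%N -> (forall i, (i < b)%N -> m i = m' i) ->
  missed_ones m col h = missed_ones m' col h.
Proof.
move=> hb colb mm'; apply: eq_bigr => i _; have := ltn_ord i => ih.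
by rewrite !mm' //; lia.
Qed.

Section DecoderInput.
Variables (R : realType) (M N D : nat) (A : 'M['F_2]_(M, N)).
Variables (e0 e1 e0' e1' : R) (y : 'rV['F_2]_M).
Local Notation input := (decoder_input A D e0 e1 e0' e1' y).

Lemma decoder_input_word (i : 'I_M) : ram_mem input i = y 0 i.
Proof.
rewrite /= nth_cat size_map size_enum_ord ltn_ord.
by rewrite (nth_map i) ?size_enum_ord // nth_ord_enum.
Qed.

Lemma decoder_input_mx (i : 'I_M) (j : 'I_N) :
  ram_mem input (M + j * M + i) = A i j.
Proof.
rewrite /= -addnA nth_cat size_map size_enum_ord ltnNge leq_addr /= addKn.
rewrite -[X in (_ * X)%N](size_enum_ord M).
by rewrite (nth_allpairs _ j i) ?size_enum_ord // !nth_ord_enum.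
Qed.

Lemma missed_ones_decoder_input (j : 'I_N) :
  missed_ones (ram_mem input) (M + j * M) M = #|col_supp A j :\: row_supp y|.
Proof.
rewrite -sum1_card [RHS]big_mkcond; apply: eq_bigr => i _.
rewrite decoder_input_word decoder_input_mx !inE negbK -!val_eqE.
by case: (_ && _).
Qed.

End DecoderInput.

Section ThresholdProgram.
Local Open Scope nat_scope.

Local Notation height := 0 (only parsing).
Local Notation columns_left := 1 (only parsing).
Local Notation threshold := 4 (only parsing).
Local Notation output := 7 (only parsing).
Local Notation entry := 8 (only parsing).
Local Notation received := 9 (only parsing).
Local Notation budget := 10 (only parsing).
Local Notation rows_left := 11 (only parsing).
Local Notation scratch := 12 (only parsing).
Local Notation one := 13 (only parsing).

Local Notation next_column := 3 (only parsing).
Local Notation next_row := 6 (only parsing).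
Local Notation row_missed := 11 (only parsing).
Local Notation row_done := 12 (only parsing).
Local Notation column_done := 16 (only parsing).
Local Notation write_bit := 19 (only parsing).
Local Notation halt := 23 (only parsing).

(* The budget of a column starts at one more than the threshold, so that it is
   positive at the end exactly when the column is accepted. *)
Definition threshold_program : ram_program :=
  [:: IConst one 1;
      ISucc threshold;
      IMove entry height;
      (* next_column *)
      IConst received 0;
      IMove budget threshold;
      IMove rows_left height;
      (* next_row *)
      ILoad scratch received;
      IJump scratch row_done;
      ILoad scratch entry;
      IJump scratch row_missed;
      IJump one row_done;
      (* row_missed *)
      IPred budget;
      (* row_done *)
      ISucc received;
      ISucc entry;
      IPred rows_left;
      IJump rows_left next_row;
      (* column_done *)
      IConst scratch 1;
      IJump budget write_bit;
      IConst scratch 0;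
      (* write_bit *)
      IStore output scratch;
      ISucc output;
      IPred columns_left;
      IJump columns_left next_column].

Local Notation reaches := (ram_reaches threshold_program).

Lemma row_test_reaches (r m : nat -> nat) : r one = 1 ->
  exists v, reaches 6 (RamState next_row r m)
    (RamState row_done (upd (upd r scratch v) budget
       (r budget - ((m (r received) == 0) && (m (r entry) != 0)))) m).
Proof.
move=> one1; have [y0|y_neq0] := eqVneq (m (r received)) 0; last first.
  exists (m (r received)), 2; rewrite // subn0 (@upd_id (upd _ _ _)).
  by rewrite /= /ram_step /= lt0n y_neq0.
have load_entry : reaches 4 (RamState next_row r m)
    (RamState (if 0 < m (r entry) then row_missed else row_missed.-1)
       (upd r scratch (m (r entry))) m).
  by exists 4; rewrite //= /ram_step /= y0 /= upd_upd.
exists (m (r entry)); apply: (ram_reaches_trans (time' := 2)) load_entry _.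
exists 1 => //; case: (m (r entry)) => [|v]; last by rewrite /= subn1.
by rewrite subn0 (@upd_id (upd _ _ _)) /= /ram_step /= [upd _ _ _ one]one1.
Qed.

Lemma row_reaches (r m : nat -> nat) : r one = 1 ->
  exists2 r', reaches 10 (RamState next_row r m)
      (RamState (if 1 < r rows_left then next_row else column_done) r' m) &
    [/\ r' received = (r received).+1, r' entry = (r entry).+1,
        r' rows_left = (r rows_left).-1,
        r' budget = r budget - ((m (r received) == 0) && (m (r entry) != 0)) &
        {in [:: height; columns_left; threshold; output; one], r' =1 r}].
Proof.
move=> /(row_test_reaches m)[v test]; eexists.
  apply: ram_reaches_trans test _; exists 4 => //=.
  by rewrite /ram_step /= -ltn_predRL.
by split=> //; apply/eq_in_map.
Qed.

Definition rows_scanned (r m : nat -> nat) (j : nat) (s : ram_state) : Prop :=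
  exists2 r',
    s = RamState (if j < r height then next_row else column_done) r' m &
    [/\ r' received = j, r' entry = r entry + j, r' rows_left = r height - j,
        r' budget = r budget - missed_ones m (r entry) j &
        {in [:: height; columns_left; threshold; output; one], r' =1 r}].

Lemma rows_scannedS (r m : nat -> nat) (j : nat) (s : ram_state) :
  r one = 1 -> j < r height -> rows_scanned r m j s ->
  exists2 s', reaches 10 s s' & rows_scanned r m j.+1 s'.
Proof.
move=> one1 lt_j [r' -> [rec' entry' rows' budget' same']].
have [|r'' run [rec'' entry'' rows'' budget'' same'']] := @row_reaches r' m.
  by rewrite same'.
eexists; first by rewrite lt_j; exact: run.
exists r''; first by rewrite rows' ltn_subRL addn1.
split; first by rewrite rec'' rec'.
- by rewrite entry'' entry' addnS.
- by rewrite rows'' rows' subnS.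
- by rewrite budget'' budget' rec' entry' /missed_ones big_ord_recr subnDA.
- by move=> i i_in; rewrite same'' ?same'.
Qed.

Lemma column_scan_reaches (r m : nat -> nat) :
  r one = 1 -> 0 < r height -> r rows_left = r height -> r received = 0 ->
  exists2 r', reaches (r height * 10) (RamState next_row r m)
                                      (RamState column_done r' m) &
    [/\ r' entry = r entry + r height,
        r' budget = r budget - missed_ones m (r entry) (r height) &
        {in [:: height; columns_left; threshold; output; one], r' =1 r}].
Proof.
move=> one1 h_gt0 rows0 rec0.
have [j s lt_j||s' run [r' s'E [_ entry' _ budget' same']]] :=
  @ram_reaches_loop threshold_program 10 (r height) (rows_scanned r m)
    (RamState next_row r m).
- exact: rows_scannedS.
- exists r; first by rewrite h_gt0.
  by split; rewrite ?addn0 ?subn0 // /missed_ones big_ord0 subn0.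
- by exists r'; rewrite // s'E ltnn in run.
Qed.

Lemma column_write_reaches (r m : nat -> nat) :
  exists2 r', reaches 7 (RamState column_done r m)
      (RamState (if 1 < r columns_left then next_column else halt) r'
         (upd m (r output) (0 < r budget))) &
    [/\ r' columns_left = (r columns_left).-1, r' output = (r output).+1 &
        {in [:: height; threshold; entry; one], r' =1 r}].
Proof.
have set_bit : reaches 3 (RamState column_done r m)
    (RamState write_bit (upd r scratch (0 < r budget)) m).
  case b: (r budget) => [|v]; [exists 3|exists 2] => //.
    by rewrite /= /ram_step /= [upd _ _ _ budget]b /= upd_upd.
  by rewrite /= /ram_step /= [upd _ _ _ budget]b.
eexists.
  apply: ram_reaches_trans set_bit _; exists 4 => //=.
  by rewrite /ram_step /= -ltn_predRL.
by split=> //; apply/eq_in_map.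
Qed.

Definition accepted (r m : nat -> nat) (j : nat) : bool :=
  missed_ones m (r entry + j * r height) (r height) < r threshold.

Lemma column_reaches (r m : nat -> nat) : r one = 1 -> 0 < r height ->
  exists2 r', reaches (10 * (r height).+1) (RamState next_column r m)
      (RamState (if 1 < r columns_left then next_column else halt) r'
         (upd m (r output) (accepted r m 0))) &
    [/\ r' columns_left = (r columns_left).-1, r' output = (r output).+1,
        r' entry = r entry + r height &
        {in [:: height; threshold; one], r' =1 r}].
Proof.
move=> one1 h_gt0.
pose r0 :=
  upd (upd (upd r received 0) budget (r threshold)) rows_left (r height).
have start : reaches 3 (RamState next_column r m) (RamState next_row r0 m).
  by exists 3.
have [//|//|//|//|r1 scan [entry1 budget1 same1]] := @column_scan_reaches r0 m.
have [r2 write [cols2 out2 same2]] := column_write_reaches r1 m.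
exists r2.
  have -> : 10 * (r height).+1 = 3 + (r height * 10 + 7) by lia.
  have := ram_reaches_trans start (ram_reaches_trans scan write).
  by rewrite budget1 subn_gt0 !same1 // /accepted addn0.
split; first by rewrite cols2 same1.
- by rewrite out2 same1.
- by rewrite same2 // entry1.
- by move=> i; rewrite !inE => /or3P[] /eqP->; rewrite same2 // same1.
Qed.

Definition columns_written (r m : nat -> nat) (j : nat) (s : ram_state) :
    Prop :=
  exists r' m',
    s = RamState (if j < r columns_left then next_column else halt) r' m' /\
    [/\ [/\ r' columns_left = r columns_left - j, r' output = r output + j &
            r' entry = r entry + j * r height],
        {in [:: height; threshold; one], r' =1 r},
        forall a, a < r output -> m' a = m a &
        forall i, i < j -> m' (r output + i) = accepted r m i].

Lemma columns_writtenS (r m : nat -> nat) (j : nat) (s : ram_state) :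
  r one = 1 -> 0 < r height ->
  r entry + r columns_left * r height <= r output ->
  j < r columns_left -> columns_written r m j s ->
  exists2 s', reaches (10 * (r height).+1) s s' & columns_written r m j.+1 s'.
Proof.
move=> one1 h_gt0 fits lt_j [r' [m' [-> [[cols' out' entry'] same' old bits]]]].
have [||r'' run [cols'' out'' entry'' same'']] := @column_reaches r' m'.
- by rewrite same'.
- by rewrite same'.
have same_bit : accepted r' m' 0 = accepted r m j.
  rewrite /accepted addn0 entry' !same' //; congr (_ < _).
  by apply: eq_missed_ones old; nia.
rewrite lt_j; eexists; first by rewrite same' // same_bit in run; exact: run.
exists r'', (upd m' (r' output) (accepted r m j)); split; last split.
- by rewrite cols' ltn_subRL addn1.
- split; first by rewrite cols'' cols' subnS.
    by rewrite out'' out' addnS.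
  by rewrite entry'' entry' same' // mulSnr addnA.
- by move=> i i_in; rewrite same'' ?same'.
- by move=> a lt_a; rewrite /upd out' ltn_eqF ?old // ltn_addr.
- move=> i; rewrite ltnS /upd out' eqn_add2l leq_eqVlt.
  by case: eqP => [->|_] //= /bits.
Qed.

Lemma threshold_program_reaches (r m : nat -> nat) :
  r one = 1 -> 0 < r height -> 0 < r columns_left ->
  r entry + r columns_left * r height <= r output ->
  exists r' m',
    reaches (r columns_left * (10 * (r height).+1))
      (RamState next_column r m) (RamState halt r' m') /\
    forall j, j < r columns_left -> m' (r output + j) = accepted r m j.
Proof.
move=> one1 h_gt0 c_gt0 fits.
have [j s lt_j||s' run [r' [m' [s'E [_ _ _ bits]]]]] :=
  @ram_reaches_loop threshold_program (10 * (r height).+1) (r columns_left)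
    (columns_written r m) (RamState next_column r m).
- exact: columns_writtenS.
- by exists r, m; rewrite c_gt0; do !split; rewrite ?subn0 ?addn0.
- by exists r', m'; rewrite s'E ltnn in run.
Qed.

Lemma threshold_program_correct (R : realType) (M N D : nat)
    (A : 'M['F_2]_(M, N)) (e0 e1 e0' e1' : R) (y : 'rV['F_2]_M) :
  0 < M -> 0 < N -> (0 <= e1)%R ->
  outputs_within threshold_program (decoder_input A D e0 e1 e0' e1' y)
    (23 * (M * N)) M (threshold_decode A e1 y).
Proof.
move=> M_gt0 N_gt0 e1_ge0; set s := decoder_input _ _ _ _ _ _ _.
pose r :=
  upd (upd (upd (ram_reg s) one 1) threshold (Num.truncn e1).+1) entry M.
have start : reaches 3 s (RamState next_column r (ram_mem s)) by exists 3.
have [//|//|//||r' [m' [scan bits]]] :=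
  @threshold_program_reaches r (ram_mem s).
  by rewrite /r /upd /= /out_addr mulnC.
have [q le_q run] := ram_reaches_trans start scan.
exists q; first by apply: leq_trans le_q _; rewrite /r /upd /=; nia.
rewrite run; split=> // j; rewrite [LHS](bits j (ltn_ord j)) mxE inE.
rewrite /accepted [missed_ones _ _ _]missed_ones_decoder_input ltnS.
by rewrite truncn_ge_nat //; case: (_ <= _)%R.
Qed.

End ThresholdProgram.

Theorem theorem2 (R : realType) :
  exists (P : ram_program) (C : nat),
  forall (n t l k k' : nat) (eps : R)
    (f : 'rV['F_2]_n -> 'rV['F_2]_t -> 'rV['F_2]_l)
    (p nu gamma : R) (D : nat),
  let K := (2 ^ k)%N in
  let K' := (2 ^ k')%N in
  let L := (2 ^ l)%N in
  let N := (2 ^ n)%N in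
  let T := (2 ^ t)%N in
  let M := (T * L)%N in
  (0 < n)%N -> (0 < t)%N -> (0 < l)%N -> (k <= n)%N -> 0 <= eps ->
  strong_condenser k k' eps f ->
  0 < p -> 0 < nu -> 0 < gamma ->
  (p + gamma) * (L%:R / K'%:R) + nu / gamma < 1 - eps ->
  D%:R = gamma * L%:R ->
  let A : 'M['F_2]_(M, N) := codeword_mx f in
  let e0 := p * M%:R in
  let e1 := nu / D%:R * M%:R in
  let e0' := K%:R - D%:R in
  let e1' := 0 in
  correcting A D e0 e1 e0' e1' /\
  forall y : 'rV['F_2]_M, exists2 z : 'rV['F_2]_N,
    valid_decoding A D e0 e1 e0' e1' y z &
    outputs_within P (decoder_input A D e0 e1 e0' e1' y) (C * (M * N)) M z.
Proof.
exists threshold_program, 23%N => n t l k k' eps f p nu gamma D K K' L N T M.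
move=> _ _ _ le_kn _ condf _ nu_gt0 gamma_gt0 lt_eps DE A e0 e1 e0' e1'.
have L_neq0 : L%:R != 0 :> R by rewrite pnatr_eq0 expn_eq0.
have delta_ge0 : 0 <= nu / gamma by rewrite divr_ge0 // ltW.
have e1E : e1 = nu / gamma * T%:R.
  by rewrite /e1 DE natrM; field; rewrite L_neq0 gt_eqF.
have valid y : valid_decoding A D e0 e1 e0' e1' y (threshold_decode A e1 y).
  rewrite e1E; apply: codeword_threshold_decode_valid condf le_kn delta_ge0 _.
  by rewrite DE -mulrDl -mulrA.
split=> y; exists (threshold_decode A e1 y) => //.
apply: threshold_program_correct; rewrite ?muln_gt0 ?expn_gt0 //.
by rewrite e1E mulr_ge0.
Qed.
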